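(* Let $X$ be a finite connected graph of genus $g$, let $B\subset V(X)$ be a subset of vertices, and let $G$ be a finite group. For each $b\in B$, let $(G_b,Y_b)\rightarrow b$ be a connected harmonic $G_b$-cover of the point $b$, where $G_b$ is isomorphic to a subgroup of $G$. For each $b\in B$ choose an embedding $\varphi_b:G_b\hookrightarrow G$, and let $G(B)$ be the subgroup of $G$ generated by the images $\varphi_b(G_b)$, $b\in B$. Assume that $G=\langle G(B),\gamma_1,\dots,\gamma_g\rangle$ for some elements $\gamma_1,\dots,\gamma_g\in G$. Then there exists a connected harmonic $G$-cover $(G,\mathcal{Y})\rightarrow X$, totally split outside of $B$, such that for each $b\in B$ the fiber $(G,\mathcal{Y}_b)\rightarrow b$ is isomorphic (as a graph with $G$-action) to the $G$-cover of $b$ induced via $\varphi_b$ from the given $G_b$-cover $(G_b,Y_b)\rightarrow b$.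
   Context: A graph is a finite multigraph without loop edges; the genus of a connected graph $X$ is $|E(X)|-|V(X)|+1$. For a vertex $v$, $v(1)$ is the subgraph consisting of $v$, its neighbours and the edges incident to $v$. A morphism of graphs $\phi:Y\to X$ maps vertices to vertices and each edge with endpoints $y_1\ne y_2$ either to an edge with endpoints $\phi(y_1)\ne\phi(y_2)$ or to the vertex $\phi(y_1)=\phi(y_2)$. It is harmonic if for each vertex $y$ the number of edges of $y(1)$ mapped to $e'$ is independent of the edge $e'$ of $\phi(y)(1)$. For a finite group $G\le\mathrm{Aut}(Y)$, the quotient $G\backslash Y$ has vertices the orbits of vertices and edges the orbits of edges with endpoints in different orbits; $(G,Y)$ (with each component stabilizer acting faithfully on its component) is a harmonic action if every quotient morphism $Y\to H\backslash Y$, $H\le G$, is harmonic, and unflipped if no non-identity element of $G$ fixes an edge. A connected harmonic $G$-cover $(G,Y)\to X$ of a connected graph $X$ consists of a connected graph $Y$ with an unflipped harmonic action of the finite group $G\le\mathrm{Aut}(Y)$ and a harmonic morphism $f:Y\to X$ with $f(g\alpha)=f(\alpha)$ for all $g$ and vertices/edges $\alpha$, inducing an isomorphism $G\backslash Y\cong X$. In particular, a connected harmonic $G_b$-cover of the point $b$ is a connected graph $Y_b$ with an unflipped harmonic action of $G_b$ that is transitive on vertices (quotient a single vertex). For $z\in V(X)$ the fiber $Y_z$ is the subgraph with vertices $f^{-1}(z)$ and the edges mapped to the vertex $z$, with its induced $G$-action. The cover is totally split at $z$ if the stabilizer in $G$ of each connected component of $Y_z$ is trivial; totally split outside $B$ means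 this holds for every $z\notin B$. The $G$-cover of $b$ induced via $\varphi_b$ from $(G_b,Y_b)$ is the graph $G\times_{G_b}Y_b$, the quotient of $G\times Y_b$ by $(g\varphi_b(h),\alpha)\sim(g,h\alpha)$ for $h\in G_b$, with $G$ acting by left multiplication on the first factor; it is a disjoint union of $[G:\varphi_b(G_b)]$ copies of $Y_b$. *)

(* Defs.v *)
From HB Require Import structures.
From mathcomp Require Export all_boot all_order all_algebra all_fingroup.
Set Implicit Arguments.
Unset Strict Implicit.
Unset Printing Implicit Defensive.

Local Open Scope group_scope.

(* Multiple edges are allowed; an edge has exactly two distinct endpoints, so
   there are no loops. *)
Record mgraph := MGraph {
  vert : finType;
  edge : finType;
  ends : edge -> {set vert};
  ends_card : forall e, #|ends e| = 2 }.

Definition adjacent (Y : mgraph) : rel (vert Y) :=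
  fun x y => [exists e : edge Y, ends e == [set x; y]].

Definition component (Y : mgraph) (x : vert Y) : {set vert Y} :=
  [set y | connect (@adjacent Y) x y].

Definition connected (Y : mgraph) : Prop :=
  0 < #|vert Y| /\ forall x y : vert Y, y \in component x.

Definition genus (X : mgraph) : int :=
  (#|edge X|%:Z - #|vert X|%:Z + 1)%R.

(* [inl e'] is the image edge of a horizontal edge, [inr x] the image vertex of
   a contracted one. *)
Record gmorphism (Y X : mgraph) := GMorphism {
  mapv : vert Y -> vert X;
  mape : edge Y -> edge X + vert X;
  map_ends : forall e, match mape e with
                       | inl e' => ends e' = [set mapv y | y in ends e]
                       | inr x => [set mapv y | y in ends e] = [set x]
                       end }.

Definition harmonic (Y X : mgraph) (f : gmorphism Y X) : Prop :=
  forall (y : vert Y) (e1 e2 : edge X),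
    mapv f y \in ends e1 -> mapv f y \in ends e2 ->
    #|[set e | (y \in ends e) && (mape f e == inl e1)]|
      = #|[set e | (y \in ends e) && (mape f e == inl e2)]|.

Record giso (Y X : mgraph) := GIso {
  isov : vert Y -> vert X;
  isoe : edge Y -> edge X;
  isov_bij : bijective isov;
  isoe_bij : bijective isoe;
  iso_ends : forall e, ends (isoe e) = [set isov y | y in ends e] }.

(* Left actions; the type [action] of the library is one of right actions. *)
Record gaction (gT : finGroupType) (Y : mgraph) := GAction {
  actv : gT -> vert Y -> vert Y;
  acte : gT -> edge Y -> edge Y;
  actv1 : forall v, actv 1 v = v;
  actvM : forall g h v, actv (g * h) v = actv g (actv h v);
  acte1 : forall e, acte 1 e = e;
  acteM : forall g h e, acte (g * h) e = acte g (acte h e);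
  act_ends : forall g e, ends (acte g e) = [set actv g v | v in ends e] }.

Definition act_iso (gT : finGroupType) (Y1 Y2 : mgraph)
    (a1 : gaction gT Y1) (a2 : gaction gT Y2) : Prop :=
  exists i : giso Y1 Y2,
    (forall g v, isov i (actv a1 g v) = actv a2 g (isov i v)) /\
    (forall g e, isoe i (acte a1 g e) = acte a2 g (isoe i e)).

Section Quotient.
Variables (gT : finGroupType) (Y : mgraph) (a : gaction gT Y) (H : {group gT}).

Definition vorbit (v : vert Y) : {set vert Y} := [set actv a h v | h in H].
Definition eorbit (e : edge Y) : {set edge Y} := [set acte a h e | h in H].

(* The endpoints of [e] lie in different orbits. *)
Definition crossing (e : edge Y) : bool := #|[set vorbit v | v in ends e]| == 2.

Definition qvert : finType :=
  {o : {set vert Y} | o \in [set vorbit v | v : vert Y]}.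
Definition qedge : finType :=
  {A : {set edge Y} | A \in [set eorbit e | e : edge Y & crossing e]}.

Fact vorbit_in v : vorbit v \in [set vorbit v | v : vert Y].
Proof. exact: imset_f. Qed.

Definition qv (v : vert Y) : qvert := exist _ (vorbit v) (vorbit_in v).

Definition qends (A : qedge) : {set qvert} :=
  \bigcup_(e in val A) [set qv v | v in ends e].

Fact qv_act h v : h \in H -> qv (actv a h v) = qv v.
Proof.
move=> hH; apply/val_inj/setP=> w /=; apply/imsetP/imsetP=> -[k kH ->].
  by exists (k * h); rewrite ?groupM ?actvM.
exists (k * h^-1); first by rewrite groupM ?groupV.
by rewrite -actvM -mulgA mulVg mulg1.
Qed.

Fact qends_orbit (e : edge Y) (A : qedge) :
  val A = eorbit e -> qends A = [set qv v | v in ends e].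
Proof.
rewrite /qends => ->; have imE h : h \in H ->
    [set qv v | v in ends (acte a h e)] = [set qv v | v in ends e].
  move=> hH; rewrite act_ends -imset_comp; apply: eq_imset => v /=.
  exact: qv_act.
apply/setP=> o; apply/bigcupP/idP => [[_ /imsetP[h hH ->]]|Oe].
  by rewrite imE.
exists e => //; apply/imsetP; exists 1; first exact: group1.
by rewrite acte1.
Qed.

Fact qimage_card (e : edge Y) :
  #|[set qv v | v in ends e]| = #|[set vorbit v | v in ends e]|.
Proof.
rewrite -(card_imset _ (@val_inj _ _ qvert)) -imset_comp.
by congr #|pred_of_set _|; apply: eq_imset.
Qed.

Fact qends_card (A : qedge) : #|qends A| = 2.
Proof.
case/imsetP: (valP A) => e; rewrite !inE => /eqP ce eA.
by rewrite (qends_orbit eA) qimage_card.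
Qed.

Definition quotient_graph : mgraph := MGraph qends_card.

Fact has_end (e : edge Y) : exists v, v \in ends e.
Proof. by apply/card_gt0P; rewrite ends_card. Qed.

Definition endpoint (e : edge Y) : vert Y := xchoose (has_end e).

(* [insub] succeeds exactly on the orbits of the crossing edges; otherwise both
   endpoints of [e] have the same image, which is that of [endpoint e]. *)
Definition qe (e : edge Y) : qedge + qvert :=
  if insub (eorbit e) is Some A then inl A else inr (qv (endpoint e)).

Fact qe_ends (e : edge Y) :
  match qe e with
  | inl A => @ends quotient_graph A = [set qv v | v in ends e]
  | inr o => [set qv v | v in ends e] = [set o]
  end.
Proof.
rewrite /qe; case: insubP => [A _ eA | /negP nA]; first exact: qends_orbit.
have eE : endpoint e \in ends e by exact: xchooseP.
have sE : [set qv (endpoint e)] \subset [set qv v | v in ends e].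
  by rewrite sub1set imset_f.
apply/esym/eqP; rewrite eqEcard sE cards1 -ltnS ltn_neqAle andTb.
have -> : #|[set qv v | v in ends e]| <= 2.
  by rewrite -(ends_card e) leq_imset_card.
rewrite andbT qimage_card; apply/negP=> ce; apply: nA; apply/imsetP; exists e => //.
by rewrite !inE.
Qed.

Definition quotient_map : gmorphism Y quotient_graph :=
  @GMorphism Y quotient_graph qv qe qe_ends.

End Quotient.

Section ActionProperties.
Variables (gT : finGroupType) (Y : mgraph) (a : gaction gT Y).

(* The induced homomorphism from [gT] to [Aut(Y)] is injective. *)
Definition faithful_act : Prop :=
  forall g, (forall v, actv a g v = v) -> (forall e, acte a g e = e) -> g = 1.

Definition component_stab (x : vert Y) : {set gT} :=
  [set g | [set actv a g y | y in component x] == component x].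

Definition component_faithful : Prop :=
  forall x g, g \in component_stab x ->
    (forall y, y \in component x -> actv a g y = y) ->
    (forall e, ends e \subset component x -> acte a g e = e) -> g = 1.

Definition harmonic_act : Prop :=
  component_faithful /\ forall H : {group gT}, harmonic (quotient_map a H).

Definition unflipped : Prop := forall g e, acte a g e = e -> g = 1.

(* [f] factors as [quotient_map a [set: gT]] followed by an isomorphism. *)
Definition quotient_iso (X : mgraph) (f : gmorphism Y X) : Prop :=
  let q := quotient_map a [set: gT] in
  exists i : giso (quotient_graph a [set: gT]) X,
    (forall v, mapv f v = isov i (mapv q v)) /\
    (forall e, mape f e = match mape q e with
                          | inl A => inl (isoe i A)
                          | inr o => inr (isov i o)
                          end).

End ActionProperties.

Record connected_cover (gT : finGroupType) (X : mgraph) := ConnectedCover {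
  cov_graph : mgraph;
  cov_act : gaction gT cov_graph;
  cov_map : gmorphism cov_graph X;
  cov_connected : connected cov_graph;
  cov_faithful : faithful_act cov_act;
  cov_harmonic_act : harmonic_act cov_act;
  cov_unflipped : unflipped cov_act;
  cov_harmonic : harmonic cov_map;
  cov_invv : forall g v, mapv cov_map (actv cov_act g v) = mapv cov_map v;
  cov_inve : forall g e, mape cov_map (acte cov_act g e) = mape cov_map e;
  cov_quotient : quotient_iso cov_act cov_map }.

Definition point_graph : mgraph :=
  @MGraph unit void (fun e => match e with end) (fun e => match e with end).

Section Fiber.
Variables (Y X : mgraph) (f : gmorphism Y X) (z : vert X).

Definition fvert : finType := {v : vert Y | mapv f v == z}.
Definition fedge : finType := {e : edge Y | mape f e == inr z}.

Definition fends (e : fedge) : {set fvert} := [set v | val v \in ends (val e)].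

Fact fends_val (e : fedge) : [set val v | v in fends e] = ends (val e).
Proof.
have /eqP ez := valP e; have := map_ends f (val e); rewrite ez => mE.
apply/setP=> v; apply/imsetP/idP => [[w + ->]|ve]; first by rewrite inE.
have vz : mapv f v == z by rewrite -in_set1 -mE imset_f.
by exists (exist _ v vz); rewrite ?inE.
Qed.

Fact fends_card (e : fedge) : #|fends e| = 2.
Proof. by rewrite -(card_imset _ (@val_inj _ _ fvert)) fends_val ends_card. Qed.

Definition fiber : mgraph := MGraph fends_card.

End Fiber.

Section FiberAction.
Variables (gT : finGroupType) (X : mgraph) (C : connected_cover gT X).
Variable z : vert X.

Let a := cov_act C.
Let F := fiber (cov_map C) z.

Fact factv_proof (g : gT) (v : vert F) :
  mapv (cov_map C) (actv a g (val v)) == z.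
Proof. by rewrite cov_invv (valP v). Qed.

Fact facte_proof (g : gT) (e : edge F) :
  mape (cov_map C) (acte a g (val e)) == inr z.
Proof. by rewrite cov_inve (valP e). Qed.

Definition factv (g : gT) (v : vert F) : vert F :=
  exist (fun w => mapv (cov_map C) w == z) _ (factv_proof g v).
Definition facte (g : gT) (e : edge F) : edge F :=
  exist (fun w => mape (cov_map C) w == inr z) _ (facte_proof g e).

Fact factv1 v : factv 1 v = v.
Proof. by apply: val_inj; rewrite /= actv1. Qed.
Fact factvM g h v : factv (g * h) v = factv g (factv h v).
Proof. by apply: val_inj; rewrite /= actvM. Qed.
Fact facte1 e : facte 1 e = e.
Proof. by apply: val_inj; rewrite /= acte1. Qed.
Fact facteM g h e : facte (g * h) e = facte g (facte h e).
Proof. by apply: val_inj; rewrite /= acteM. Qed.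
Fact fact_ends g e : ends (facte g e) = [set factv g v | v in ends e].
Proof.
apply: (imset_inj (@val_inj _ _ (fvert (cov_map C) z))).
rewrite fends_val /= act_ends -fends_val -!imset_comp.
exact: eq_imset.
Qed.

Definition fiber_act : gaction gT F :=
  GAction factv1 factvM facte1 facteM fact_ends.

Definition totally_split : Prop :=
  forall x : vert F, component_stab fiber_act x = [set 1].

End FiberAction.

(* An action that commutes with [a] descends to the quotient by [a]: an orbit is
   sent to its image. *)
Section Descent.
Variables (hT gT : finGroupType) (Y : mgraph).
Variables (a : gaction hT Y) (H : {group hT}) (k : gaction gT Y).
Hypothesis comv : forall g h v, actv k g (actv a h v) = actv a h (actv k g v).
Hypothesis come : forall g h e, acte k g (acte a h e) = acte a h (acte k g e).

Fact vorbit_im g v : [set actv k g w | w in vorbit a H v]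
                     = vorbit a H (actv k g v).
Proof. by rewrite -imset_comp; apply: eq_imset => h /=; rewrite comv. Qed.

Fact eorbit_im g e : [set acte k g w | w in eorbit a H e]
                     = eorbit a H (acte k g e).
Proof. by rewrite -imset_comp; apply: eq_imset => h /=; rewrite come. Qed.

Fact actv_inj g : injective (actv k g).
Proof.
by apply: (can_inj (g := actv k g^-1)) => v; rewrite -actvM mulVg actv1.
Qed.

Fact crossing_act g e : crossing a H e -> crossing a H (acte k g e).
Proof.
rewrite /crossing act_ends -imset_comp => /eqP <-; apply/eqP.
rewrite -[RHS](card_imset _ (imset_inj (@actv_inj g))) -imset_comp.
by congr #|pred_of_set _|; apply: eq_imset => v /=; rewrite vorbit_im.
Qed.

Fact dactv_proof g (o : qvert a H) :
  [set actv k g w | w in val o] \in [set vorbit a H v | v : vert Y].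
Proof. by case/imsetP: (valP o) => v _ ->; rewrite vorbit_im imset_f. Qed.

Fact dacte_proof g (A : qedge a H) :
  [set acte k g e | e in val A]
    \in [set eorbit a H e | e : edge Y & crossing a H e].
Proof.
case/imsetP: (valP A) => e; rewrite !inE => ce ->; rewrite eorbit_im.
by apply: imset_f; rewrite !inE crossing_act.
Qed.

Definition dactv g (o : qvert a H) : qvert a H :=
  exist (fun S => S \in [set vorbit a H v | v : vert Y]) _ (dactv_proof g o).
Definition dacte g (A : qedge a H) : qedge a H :=
  exist (fun S => S \in [set eorbit a H e | e : edge Y & crossing a H e]) _
    (dacte_proof g A).

Fact dactv1 o : dactv 1 o = o.
Proof.
apply: val_inj => /=; rewrite -[RHS]imset_id.
by apply: eq_imset => v; rewrite actv1.
Qed.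
Fact dactvM g h o : dactv (g * h) o = dactv g (dactv h o).
Proof.
apply: val_inj => /=; rewrite -imset_comp.
by apply: eq_imset => v; rewrite actvM.
Qed.
Fact dacte1 A : dacte 1 A = A.
Proof.
apply: val_inj => /=; rewrite -[RHS]imset_id.
by apply: eq_imset => e; rewrite acte1.
Qed.
Fact dacteM g h A : dacte (g * h) A = dacte g (dacte h A).
Proof.
apply: val_inj => /=; rewrite -imset_comp.
by apply: eq_imset => e; rewrite acteM.
Qed.
Fact dact_ends g (A : edge (quotient_graph a H)) :
  @ends (quotient_graph a H) (dacte g A) = [set dactv g o | o in ends A].
Proof.
case/imsetP: (valP A) => e _ eA.
rewrite /= (qends_orbit eA) (@qends_orbit _ _ _ _ (acte k g e)); last first.
  by rewrite /= eA eorbit_im.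
rewrite act_ends -!imset_comp; apply: eq_imset => v /=.
by apply: val_inj; rewrite /= vorbit_im.
Qed.

Definition descended_act : gaction gT (quotient_graph a H) :=
  @GAction gT (quotient_graph a H) dactv dacte
    dactv1 dactvM dacte1 dacteM dact_ends.

End Descent.

(* [induced_graph] is the quotient of [gT x Y] by the equivalence relation
   (g phi(h), alpha) ~ (g, h alpha), whose classes are the orbits of the action
   h (g, alpha) = (g phi(h)^-1, h alpha) of [hT]. When [phi] is injective no
   edge of [gT x Y] has equivalent endpoints (see [twist_crossing]), so that
   [quotient_graph] keeps the classes of all the edges. *)
Section Induced.
Variables (hT gT : finGroupType) (Y : mgraph) (a : gaction hT Y).
Variable phi : {morphism [set: hT] >-> gT}.

Definition pends (p : gT * edge Y) : {set gT * vert Y} :=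
  [set (p.1, v) | v in ends p.2].

Fact pends_card p : #|pends p| = 2.
Proof. by rewrite card_imset ?ends_card // => v w []. Qed.

Definition prod_graph : mgraph := MGraph pends_card.

Definition twist (T : Type) (act : hT -> T -> T) (h : hT) (p : gT * T) :=
  (p.1 * (phi h)^-1, act h p.2).
Definition ltrans (T : Type) (k : gT) (p : gT * T) := (k * p.1, p.2).

Fact twistv1 p : twist (actv a) 1 p = p.
Proof. by case: p => g v; rewrite /twist morph1 invg1 mulg1 actv1. Qed.
Fact twistvM h1 h2 p :
  twist (actv a) (h1 * h2) p = twist (actv a) h1 (twist (actv a) h2 p).
Proof. by rewrite /twist morphM ?inE //= invMg mulgA actvM. Qed.
Fact twiste1 p : twist (acte a) 1 p = p.
Proof. by case: p => g v; rewrite /twist morph1 invg1 mulg1 acte1. Qed.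
Fact twisteM h1 h2 p :
  twist (acte a) (h1 * h2) p = twist (acte a) h1 (twist (acte a) h2 p).
Proof. by rewrite /twist morphM ?inE //= invMg mulgA acteM. Qed.
Fact twist_ends h (p : edge prod_graph) :
  @ends prod_graph (twist (acte a) h p)
    = [set twist (actv a) h v | v in @ends prod_graph p].
Proof. by rewrite /= /pends /= act_ends -!imset_comp; apply: eq_imset. Qed.

Definition twist_act : gaction hT prod_graph :=
  @GAction hT prod_graph _ _ twistv1 twistvM twiste1 twisteM twist_ends.

Fact ltrans1 (T : Type) (p : gT * T) : ltrans 1 p = p.
Proof. by case: p => g v; rewrite /ltrans mul1g. Qed.
Fact ltransM (T : Type) k1 k2 (p : gT * T) :
  ltrans (k1 * k2) p = ltrans k1 (ltrans k2 p).
Proof. by rewrite /ltrans mulgA. Qed.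
Fact ltrans_ends k (p : edge prod_graph) :
  @ends prod_graph (ltrans k p) = [set ltrans k v | v in @ends prod_graph p].
Proof. by rewrite /= /pends -imset_comp; apply: eq_imset. Qed.

Definition ltrans_act : gaction gT prod_graph :=
  @GAction gT prod_graph _ _ (@ltrans1 _) (@ltransM _) (@ltrans1 _)
    (@ltransM _) ltrans_ends.

Fact ltrans_twistv k h p : actv ltrans_act k (actv twist_act h p)
                           = actv twist_act h (actv ltrans_act k p).
Proof. by rewrite /= /ltrans /twist mulgA. Qed.
Fact ltrans_twiste k h p : acte ltrans_act k (acte twist_act h p)
                           = acte twist_act h (acte ltrans_act k p).
Proof. by rewrite /= /ltrans /twist mulgA. Qed.

Fact twist_crossing p : 'injm phi -> crossing twist_act [set: hT] p.
Proof.
move=> inj; apply/eqP; rewrite -[RHS](pends_card p) card_in_imset //.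
move=> _ _ /imsetP[v _ ->] /imsetP[w _ ->] eqO.
have: (p.1, v) \in vorbit twist_act [set: hT] (p.1, v).
  by apply/imsetP; exists 1; rewrite ?inE ?actv1.
rewrite eqO => /imsetP[h _ [+ ->]].
rewrite -{1}[p.1]mulg1 => /mulgI/esym/eqP; rewrite eq_invg1 => /eqP ph.
suff ->: h = 1 by rewrite actv1.
by apply: (injmP inj); rewrite ?inE // ph morph1.
Qed.

Definition induced_graph : mgraph := quotient_graph twist_act [set: hT].
Definition induced_act : gaction gT induced_graph :=
  descended_act [set: hT] ltrans_twistv ltrans_twiste.

End Induced.

(* Main.v *)
Require Import Defs.
(* Glue the graphs with G-action prescribed over the vertices of X, namely
   G x_{G_b} Y_b over b in B and the edgeless graph G elsewhere, by edges (k, e)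
   for k in G and e in E(X): if e joins x to y, (k, e) joins k p_x to
   k lab(e) p_y, where p_z is a base point over z, and lab(e) is 1 on a spanning
   tree and runs through the gamma_i on the g other edges. G permutes the edges
   freely, which forces all its quotient maps to be harmonic. The p_z are linked
   by the lifted tree, so the k with k p_r connected to p_r form a subgroup; it
   contains the gamma_i and the phi_b(G_b), the latter because Y_b is connected,
   hence is G. *)
Set Implicit Arguments.
Unset Strict Implicit.
Unset Printing Implicit Defensive.
Local Open Scope group_scope.

Lemma inj_surj_bij (T U : finType) (f : T -> U) :
  injective f -> (forall y, exists x, f x = y) -> bijective f.
Proof.
by move=> fI /fin_all_exists[g fK]; exists g => // x; apply: fI; rewrite fK.
Qed.

(** * Group actions on graphs and their quotient maps *)

Section Actions.
Variables (gT : finGroupType) (Y : mgraph) (a : gaction gT Y).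

Lemma acteK g : cancel (acte a g) (acte a g^-1).
Proof. by move=> e; rewrite -acteM mulVg acte1. Qed.

Lemma vorbit_refl (H : {group gT}) v : v \in vorbit a H v.
Proof. by apply/imsetP; exists 1; rewrite ?group1 ?actv1. Qed.

Lemma eorbit_refl (H : {group gT}) e : e \in eorbit a H e.
Proof. by apply/imsetP; exists 1; rewrite ?group1 ?acte1. Qed.

Lemma qv_eqP (H : {group gT}) v w :
  reflect (exists2 h, h \in H & w = actv a h v) (qv a H w == qv a H v).
Proof.
apply: (iffP eqP) => [/(congr1 val) /= eqO|[h hH ->]]; last exact: qv_act.
by apply/imsetP; rewrite -/(vorbit a H v) -eqO vorbit_refl.
Qed.

Lemma eorbit_act (H : {group gT}) h e :
  h \in H -> eorbit a H (acte a h e) = eorbit a H e.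
Proof.
move=> hH; apply/setP=> w; apply/imsetP/imsetP=> -[k kH ->].
  by exists (k * h); rewrite ?groupM ?acteM.
exists (k * h^-1); first by rewrite groupM ?groupV.
by rewrite -acteM -mulgA mulVg mulg1.
Qed.

Lemma connect_act g v w :
  connect (@adjacent Y) v w -> connect (@adjacent Y) (actv a g v) (actv a g w).
Proof.
case/connectP=> p + ->;
elim: p v => [|u p IHp] v //= /andP[/existsP[e /eqP eE]].
move=> /IHp; apply: connect_trans; apply/connect1/existsP; exists (acte a g e).
by rewrite act_ends eE imsetU1 imset_set1.
Qed.

(** Orbits are disjoint or equal, so the [insub] defining [qe] returns [A] on its members and
    nowhere else. *)
Lemma qe_inl (H : {group gT}) e (A : qedge a H) :
  (qe a H e == inl A) = (e \in val A).
Proof.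
have [e0 _ A0] := imsetP (valP A); rewrite /qe.
case: insubP => [A' _ A'E|nA].
  apply/eqP/idP=> [[<-]|]; first by rewrite A'E eorbit_refl.
  rewrite A0 => /imsetP[h hH eE]; congr inl; apply: val_inj.
  by rewrite A'E eE eorbit_act.
apply/eqP/idP=> // eA; case/negP: nA; have:= valP A.
by move: eA; rewrite A0 => /imsetP[h hH ->]; rewrite eorbit_act.
Qed.

(* An edge e = {y, y'} crossing the orbits of H is moved to an edge at y by h
   in H exactly when h fixes y; as H acts freely on edges, e has #|stab y|
   translates at y, whatever e is. *)
Lemma unflipped_harmonic (H : {group gT}) :
  unflipped a -> harmonic (quotient_map a H).
Proof.
move=> unf y; pose q := quotient_map a H.
suff cnt A : mapv q y \in ends A ->
    #|[set e | (y \in ends e) && (mape q e == inl A)]|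
      = #|[set h in H | actv a h y == y]|.
  move=> A1 A2 y1 y2; apply: etrans (cnt A1 y1) _;
  apply: esym; exact: cnt A2 y2.
have [e0] := imsetP (valP A); rewrite !inE => cr0 A0.
(* Some [h0] moves the end [y0] of the representative [e0] to [y], so [acte a h0 e0] is a
   representative of [A] at [y]. *)
rewrite [ends A](qends_orbit A0) => /imsetP[y0 y0e /eqP/qv_eqP[h0 h0H yE]].
have eA e : (qe a H e == inl A) = (e \in eorbit a H e0) by rewrite qe_inl A0.
have y_e : y \in ends (acte a h0 e0) by rewrite act_ends yE imset_f.
have cr : crossing a H (acte a h0 e0).
  have := @qimage_card _ _ a H (acte a h0 e0); rewrite /crossing => <-.
  rewrite -(@qends_orbit _ _ a H (acte a h0 e0) A) ?qends_card //.
  by rewrite eorbit_act.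
rewrite -(card_in_imset (f := fun h => acte a h (acte a h0 e0))); last first.
  move=> h k _ _ /(congr1 (acte a k^-1)); rewrite acteK -acteM => /unf /eqP.
  by rewrite -eq_invg_mul invgK eq_sym => /eqP.
apply: eq_card => e; rewrite inE eA -(eorbit_act e0 h0H).
apply/andP/imsetP=> [[ye /imsetP[h hH eE]]|[h + ->]]; last first.
  rewrite inE => /andP[hH /eqP hy]; rewrite act_ends -{1}hy.
  by split; apply: imset_f.
exists h => //; rewrite inE hH /=.
(* Here [y] is the image under [h] of an end [w] of the chosen edge. If [w] were the other end, both
   ends would lie in one orbit, against [cr]. *)
move: ye; rewrite eE act_ends => /imsetP[w we yw].
suff yw' : y = w by rewrite {1}yw' -yw.
move: cr; apply: contraTeq => nyw; rewrite /crossing.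
have /eqP-> : ends (acte a h0 e0) == [set y; w].
  by rewrite eq_sym eqEcard ends_card cards2 nyw andbT subUset !sub1set y_e.
rewrite imsetU1 imset_set1.
have /(congr1 val) /= -> : qv a H y = qv a H w by rewrite yw qv_act.
by rewrite setUid cards1.
Qed.

Lemma connected_faithful :
  connected Y -> faithful_act a -> component_faithful a.
Proof.
move=> [_ cY] fa x g _ fv fe; apply: fa => [v|e]; first exact: fv.
by apply: fe; apply/subsetP=> v _.
Qed.

(** The isomorphism with [X] only renames the edges over which harmonicity counts. *)
Lemma quotient_iso_harmonic (X : mgraph) (f : gmorphism Y X) :
  harmonic (quotient_map a [set: gT]) -> quotient_iso a f -> harmonic f.
Proof.
move=> hq [i [iv ie]] y e1 e2.
have [j iK jK] := isoe_bij i; have vinj := bij_inj (isov_bij i).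
rewrite iv -(jK e1) -(jK e2) !iso_ends !(mem_imset _ _ vinj) => y1 y2.
have eqE A : [set e | (y \in ends e) && (mape f e == inl (isoe i A))]
    = [set e | (y \in ends e) && (mape (quotient_map a [set: gT]) e == inl A)].
  apply/setP=> e; rewrite !inE ie; congr andb.
  case: (mape _ e) => // A'; apply/eqP/eqP=> [[/(can_inj iK)->]|[->]] //.
by rewrite !eqE; apply: hq.
Qed.

(** The crossing edges turn out to be those that [f] maps to edges. Invariance lets [f] descend to
    orbits; the orbit hypotheses give injectivity there. *)
Lemma quotient_iso_orbits (X : mgraph) (f : gmorphism Y X) :
    (forall g v, mapv f (actv a g v) = mapv f v) ->
    (forall g e, mape f (acte a g e) = mape f e) ->
    (forall x, exists v, mapv f v = x) ->
    (forall e', exists e, mape f e = inl e') ->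
    (forall v w, mapv f v = mapv f w -> exists g, w = actv a g v) ->
    (forall e1 e2 e', mape f e1 = inl e' -> mape f e2 = inl e' ->
       exists g, e2 = acte a g e1) ->
  quotient_iso a f.
Proof.
move=> invv inve surv sure orbv orbe; pose G := [set: gT]%G.
have crE e : crossing a G e = (if mape f e is inl _ then true else false).
  rewrite /crossing -qimage_card; have := map_ends f e.
  (* Ends with distinct images lie in distinct orbits by invariance. The ends of a contracted edge
     share a fibre, hence an orbit. *)
  case: (mape f e) => [e'|x] fE.
    rewrite -(ends_card e) card_in_imset ?eqxx //
      => v w ve we /eqP/qv_eqP[g _ vw].
    have /imset_injP fI : #|[set mapv f v | v in ends e]| == #|ends e|.
      by rewrite -fE !ends_card.
    by apply: fI => //; rewrite vw invv.
  have [u ue] := has_end e.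
  suff -> : [set qv a G v | v in ends e] = [set qv a G u] by rewrite cards1.
  apply/setP=> o; rewrite inE;
  apply/imsetP/eqP=> [[v ve ->]|->]; last by exists u.
  have fx w : w \in ends e -> mapv f w = x.
    by move=> we; apply/set1P; rewrite -fE imset_f.
  have [g ->] := orbv u v (etrans (fx u ue) (esym (fx v ve))).
  by apply: qv_act; rewrite inE.
have isovP (o : qvert a G) : exists x, forall v, v \in val o -> mapv f v = x.
  have [v _ oE] := imsetP (valP o); exists (mapv f v) => w.
  by rewrite oE => /imsetP[g _ ->].
have isoeP (A : qedge a G) : exists e',
    forall e, e \in val A -> mape f e = inl e'.
  have [e] := imsetP (valP A); rewrite inE crE => fe AE.
  case fE: (mape f e) fe => [e'|//] _; exists e' => w.
  by rewrite AE => /imsetP[g _ ->]; rewrite inve.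
have [iv ivP] := fin_all_exists isovP; have [ie ieP] := fin_all_exists isoeP.
have ivq v : iv (qv a G v) = mapv f v by apply/esym/ivP; exact: vorbit_refl.
have qvS (o : qvert a G) : exists v, o = qv a G v.
  by have [v _ oE] := imsetP (valP o); exists v; apply: val_inj.
have qeS (A : qedge a G) : exists e, qe a G e = inl A.
  have [e _ AE] := imsetP (valP A); exists e.
  by apply/eqP; rewrite qe_inl AE eorbit_refl.
have ieq e A : qe a G e = inl A -> mape f e = inl (ie A).
  by move/eqP; rewrite qe_inl => /ieP.
have qeI e e' : mape f e = inl e' -> exists A, qe a G e = inl A.
  move=> fe.
  have eA : eorbit a G e \in [set eorbit a G e | e : edge Y & crossing a G e].
    by apply: imset_f; rewrite inE crE fe.
  exists (exist (fun A => A \in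
    [set eorbit a G e | e : edge Y & crossing a G e])
    _ eA).
  by apply/eqP; rewrite qe_inl eorbit_refl.
have iv_bij : bijective iv.
  apply: inj_surj_bij => [o1 o2|x].
    have [v ->] := qvS o1; have [w ->] := qvS o2; rewrite !ivq => /orbv[g ->].
    by rewrite qv_act ?inE.
  by have [v <-] := surv x; exists (qv a G v).
have ie_bij : bijective ie.
  apply: inj_surj_bij => [A1 A2 eA|e'].
    have [e1 q1] := qeS A1; have [e2 q2] := qeS A2.
    have [|g e2E] := orbe e1 e2 (ie A1) (ieq _ _ q1);
      first by rewrite eA; exact: ieq.
    have : e2 \in val A1.
      have := eqxx (qe a G e1); rewrite {2}q1 qe_inl.
      have [e _ ->] := imsetP (valP A1) => /imsetP[h _ e1E].
      by rewrite e2E e1E -acteM; apply: imset_f; rewrite inE.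
    by rewrite -qe_inl q2 => /eqP[].
  have [e fe] := sure e'; have [A qA] := qeI _ _ fe.
  by exists A; have := ieq _ _ qA; rewrite fe => -[].
have ends_i (A : edge (quotient_graph a G)) :
    ends (ie A) = [set iv o | o in ends A].
  have [e qA] := qeS A; have := qe_ends a G e; rewrite qA => ->.
  have := map_ends f e; rewrite (ieq _ _ qA) => ->; rewrite -imset_comp.
  by apply: eq_imset => v /=; rewrite ivq.
exists (@GIso (quotient_graph a G) X iv ie iv_bij ie_bij ends_i); split=> [v|e];
  first exact/esym/ivq.
rewrite /=; case qE: (qe a G e) => [A|o] /=; first exact: ieq.
(* An edge contracted in the quotient is contracted by [f]; the two image vertices are compared at
   an end [u]. *)
case fE: (mape f e) => [e'|x]; first by have [A] := qeI _ _ fE; rewrite qE.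
have := qe_ends a G e; rewrite qE => qo; have := map_ends f e; rewrite fE => fx.
have [u ue] := has_end e; congr inr.
have /set1P<- : mapv f u \in [set x] by rewrite -fx imset_f.
have /set1P<- : qv a G u \in [set o] by rewrite -qo imset_f.
by rewrite ivq.
Qed.

End Actions.

(** * Equivariant isomorphism is an equivalence relation *)

Lemma act_iso_refl (gT : finGroupType) (Y : mgraph) (a : gaction gT Y) :
  act_iso a a.
Proof.
have idE (e : edge Y) : ends (id e) = [set id v | v in ends e]
  by rewrite imset_id.
have idB (T : Type) : bijective (@id T) by exists id.
by exists (GIso (idB _) (idB _) idE).
Qed.

Lemma act_iso_sym (gT : finGroupType) (Y1 Y2 : mgraph)
    (a1 : gaction gT Y1) (a2 : gaction gT Y2) :
  act_iso a1 a2 -> act_iso a2 a1.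
Proof.
case=> -[iv ie [jv ivK jvK] [je ieK jeK] iE] /= [eqv eqe].
have jE e : ends (je e) = [set jv v | v in ends e].
  apply: (imset_inj (can_inj ivK)); rewrite -iE jeK -imset_comp -[LHS]imset_id.
  by apply: eq_imset => v; rewrite /= jvK.
exists (GIso (Bijective jvK ivK) (Bijective jeK ieK) jE); split=> g x /=.
  by apply: (can_inj ivK); rewrite eqv !jvK.
by apply: (can_inj ieK); rewrite eqe !jeK.
Qed.

Lemma act_iso_trans (gT : finGroupType) (Y1 Y2 Y3 : mgraph)
    (a1 : gaction gT Y1) (a2 : gaction gT Y2) (a3 : gaction gT Y3) :
  act_iso a1 a2 -> act_iso a2 a3 -> act_iso a1 a3.
Proof.
case=> -[iv ie vB eB iE] /= [eqv eqe] [[jv je vB' eB' jE] /= [eqv' eqe']].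
have kE e : ends ((je \o ie) e) = [set (jv \o iv) v | v in ends e].
  by rewrite /= jE iE -imset_comp.
exists (GIso (bij_comp vB' vB) (bij_comp eB' eB) kE); split=> g x /=.
  by rewrite eqv eqv'.
by rewrite eqe eqe'.
Qed.

(** * Spanning trees and edge labels *)

Section SpanningTree.
Variable X : mgraph.

Definition adjacent_in (T : {set edge X}) : rel (vert X) :=
  fun x y => [exists e in T, ends e == [set x; y]].

Lemma adjacent_in_sym T : symmetric (adjacent_in T).
Proof. by move=> x y; apply: eq_existsb => e; rewrite setUC. Qed.

(** If no edge left [S], it would be closed under adjacency and contain [z] along with [r]. *)
Lemma connected_exit (S : {set vert X}) r z :
    connected X -> r \in S -> z \notin S ->
  exists e x y, [/\ x \in S, y \notin S & ends e = [set x; y]].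
Proof.
move=> [_ cX] rS zS; have := cX r z; rewrite inE => rz.
case: (pickP [pred p : edge X * (vert X * vert X) | [&& p.2.1 \in S,
  p.2.2 \notin S & ends p.1 == [set p.2.1; p.2.2]]])
  => [[e [x y]] /and3P[/= xS yS /eqP eE]|none].
  by exists e, x, y.
case/negP: zS; rewrite -(closed_connect _ rz) //.
apply: intro_closed => [|x y /existsP[e eE] xS].
  by apply: sym_connect_sym => u w; apply: eq_existsb => e'; rewrite setUC.
by apply: contraT => yS; have := none (e, (x, y)); rewrite /= xS yS eE.
Qed.

(** A set of vertices grows from [r], gaining one vertex and at most one edge at a time. The bound
    on [#|T|] stands in for acyclicity. *)
Lemma spanning_edges : connected X ->
  exists T : {set edge X}, #|T| < #|vert X|
    /\ forall x y, connect (adjacent_in T) x y.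
Proof.
move=> hX; have [/card_gt0P[r _] _] := hX.
suff grow n : n < #|vert X| -> exists (S : {set vert X}) (T : {set edge X}),
    [/\ r \in S, #|S| = n.+1, #|T| <= n
      & forall x, x \in S -> connect (adjacent_in T) r x].
  (* At this [n] the set [S] has as many elements as there are vertices, so it is everything. *)
  have [|S [T [_ cS cT rT]]] := grow #|vert X|.-1.
    by rewrite prednK //; apply/card_gt0P; exists r.
  have V0 : 0 < #|vert X| by apply/card_gt0P; exists r.
  have ST x : x \in S.
    suff /eqP-> : S == setT by rewrite inE.
    by rewrite eqEcard subsetT cardsT cS prednK /=.
  exists T; split=> [|x y]; first by rewrite -(prednK V0) ltnS.
  apply: connect_trans (rT y (ST y)).
  by rewrite (sym_connect_sym (@adjacent_in_sym T)) rT.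
elim: n => [_|n IHn ltn].
  exists [set r], set0; split; rewrite ?inE ?cards1 ?cards0 // => x /set1P->.
  exact: connect0.
have [S [T [rS cS cT rT]]] := IHn (ltnW ltn).
have [z zS] : exists z, z \notin S.
  apply/existsP; rewrite -negb_forall; apply: contraTN ltn => /forallP allS.
  by rewrite -leqNgt -cS -cardsT subset_leq_card //; apply/subsetP=> z _.
have [e [x [y [xS yS eE]]]] := connected_exit hX rS zS.
have sub : subrel (connect (adjacent_in T)) (connect (adjacent_in (e |: T))).
  apply: connect_sub => u v /existsP[e' /andP[e'T e'E]]; apply/connect1/existsP.
  by exists e'; rewrite setU1r.
exists (y |: S), (e |: T); split.
- exact: setU1r.
- by rewrite cardsU1 yS cS.
- by rewrite cardsU1; case: (e \in T) => //=; rewrite ?add0n ?ltnS // leqW.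
- move=> w /setU1P[->|/rT/sub//].
  apply: connect_trans (sub _ _ (rT _ xS)) _; apply/connect1/existsP; exists e.
  by rewrite setU11 eE eqxx.
Qed.

(* The labels are carried by the edges outside a spanning tree, of which there
   are at least [g]. *)
Lemma tree_labelling (gT : finGroupType) g (gamma : 'I_g -> gT) :
    connected X -> genus X = Posz g ->
  exists lab : edge X -> gT,
    (forall i, exists e, lab e = gamma i)
    /\ (forall x y, connect (adjacent_in [set e | lab e == 1]) x y).
Proof.
move=> hX hg; have [T [cT Tc]] := spanning_edges hX.
(* The genus formula reads |E| + 1 = g + |V|, while |T| + 1 <= |V|. *)
have leg : g <= #|~: T|.
  rewrite -(leq_add2l #|T|) cardsC.
  have : (Posz (#|edge X| + 1)%N = Posz (g + #|vert X|)%N).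
    by rewrite !PoszD -hg /genus GRing.addrAC GRing.subrK.
  by case=> hE; rewrite -(leq_add2r 1) hE addn1 addnC -addnS leq_add2l.
pose f i : edge X := enum_val (widen_ord leg i).
have fI : injective f by move=> i j /enum_val_inj/(congr1 val) /= /val_inj.
(* The image of [f] avoids [T], so the default 1 covers all edges of [T]. *)
pose lab e := if [pick i | f i == e] is Some i then gamma i else 1.
exists lab; split=> [i|x y].
  exists (f i); rewrite /lab; case: pickP => [j /eqP/fI-> //|/(_ i)].
  by rewrite eqxx.
move: x y (Tc x y); apply: connect_sub => x y /existsP[e /andP[eT eE]].
apply/connect1/existsP; exists e; rewrite eE andbT inE /lab.
case: pickP => // i /eqP fE; have := enum_valP (widen_ord leg i).
by rewrite -/(f i) fE inE eT.
Qed.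

End SpanningTree.

(** * Gluing graphs with action along the edges of [X] *)

Lemma edge_ends (X : mgraph) (e : edge X) :
  exists xy : vert X * vert X, ends e = [set xy.1; xy.2].
Proof. by have /eqP/cards2P[x [y [_ eE]]] := ends_card e; exists (x, y). Qed.

Section Gluing.
Variables (X : mgraph) (gT : finGroupType) (F : vert X -> mgraph).
Variables (a : forall z, gaction gT (F z)) (p : forall z, vert (F z)).
Variables (st : edge X -> vert X * vert X) (lab : edge X -> gT).
Hypothesis st_ends : forall e, ends e = [set (st e).1; (st e).2].

Definition glue_vert : finType := {z : vert X & vert (F z)}.
(** [inl (k, e)] is the [k]-translate of one lift of [e]; the right summand holds the edges inside
    fibres. The orientation [st] tells which end of [e] receives the label. *)
Definition glue_edge : finType :=
  (gT * edge X + {z : vert X & edge (F z)})%type.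

Definition fibv z (v : vert (F z)) : glue_vert :=
  Tagged (fun z => vert (F z)) v.
Definition fibe z (e : edge (F z)) : glue_edge :=
  inr (Tagged (fun z => edge (F z)) e).

Definition glue_ends (e : glue_edge) : {set glue_vert} :=
  match e with
  | inl (k, e) => [set fibv (actv (a (st e).1) k (p (st e).1));
                       fibv (actv (a (st e).2) (k * lab e) (p (st e).2))]
  | inr e => [set fibv v | v in ends (tagged e)]
  end.

Lemma fibv_inj z : injective (@fibv z).
Proof. by move=> v w /eqP; rewrite eq_Tagged => /eqP. Qed.

Lemma fibe_inj z : injective (@fibe z).
Proof. by move=> v w [/eqP]; rewrite eq_Tagged => /eqP. Qed.

Fact glue_ends_card e : #|glue_ends e| = 2.
Proof.
case: e => [[k e]|[z e]] /=; last by
  rewrite (card_imset _ (@fibv_inj z)) ends_card.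
(* The two ends lie over the ends of [e], which are distinct. *)
rewrite cards2; case: eqP => // /(congr1 tag) /= sE.
by have := ends_card e; rewrite st_ends sE setUid cards1.
Qed.

Definition glue_graph : mgraph := MGraph glue_ends_card.

Definition glue_actv (g : gT) (v : vert glue_graph) : vert glue_graph :=
  fibv (actv (a (tag v)) g (tagged v)).
Definition glue_acte (g : gT) (e : edge glue_graph) : edge glue_graph :=
  match e with
  | inl (k, e) => inl (g * k, e)
  | inr e => fibe (acte (a (tag e)) g (tagged e))
  end.

Fact glue_actv1 v : glue_actv 1 v = v.
Proof. by case: v => z v; rewrite /glue_actv actv1. Qed.
Fact glue_actvM g h v : glue_actv (g * h) v = glue_actv g (glue_actv h v).
Proof. by case: v => z v; rewrite /glue_actv actvM. Qed.
Fact glue_acte1 e : glue_acte 1 e = e.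
Proof. by case: e => [[k e]|[z e]]; rewrite /glue_acte ?mul1g ?acte1. Qed.
Fact glue_acteM g h e : glue_acte (g * h) e = glue_acte g (glue_acte h e).
Proof. by case: e => [[k e]|[z e]]; rewrite /glue_acte ?mulgA ?acteM. Qed.
Fact glue_act_ends g e :
  ends (glue_acte g e) = [set glue_actv g v | v in ends e].
Proof.
case: e => [[k e]|[z e]] /=; last by
  rewrite act_ends -!imset_comp; apply: eq_imset.
by rewrite imsetU1 imset_set1 /glue_actv /= -mulgA !actvM.
Qed.

Definition glue_act : gaction gT glue_graph :=
  GAction glue_actv1 glue_actvM glue_acte1 glue_acteM glue_act_ends.

Definition glue_mapv (v : vert glue_graph) : vert X := tag v.
Definition glue_mape (e : edge glue_graph) : edge X + vert X :=
  match e with inl (_, e) => inl e | inr e => inr (tag e) end.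

Fact glue_map_ends e :
  match glue_mape e with
  | inl e' => ends e' = [set glue_mapv y | y in ends e]
  | inr x => [set glue_mapv y | y in ends e] = [set x]
  end.
Proof.
case: e => [[k e]|[z e]] /=; first by rewrite imsetU1 imset_set1 st_ends.
rewrite -imset_comp; apply/setP=> x; rewrite inE;
apply/imsetP/eqP=> [[v _ ->]|->] //.
by have [v ve] := has_end e; exists v.
Qed.

Definition glue_map : gmorphism glue_graph X := GMorphism glue_map_ends.

Fact glue_invv g v : mapv glue_map (actv glue_act g v) = mapv glue_map v.
Proof. by []. Qed.

Fact glue_inve g e : mape glue_map (acte glue_act g e) = mape glue_map e.
Proof. by case: e => [[k e]|e]. Qed.

Hypothesis unf : forall z, unflipped (a z).

Lemma glue_unflipped : unflipped glue_act.
Proof.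
move=> g [[k e]|[z e]] /=; last by move/fibe_inj/unf.
by case=> /eqP; rewrite -{2}[k]mul1g => /eqP/mulIg.
Qed.

Hypothesis trans : forall z v, exists g, v = actv (a z) g (p z).

Lemma glue_quotient_iso : quotient_iso glue_act glue_map.
Proof.
apply: (quotient_iso_orbits glue_invv glue_inve).
- by move=> x; exists (fibv (p x)).
- by move=> e; exists (inl (1, e)).
- move=> [z v] [z' w] /= zz'; rewrite /glue_mapv /= in zz'; subst z'.
  have [g ->] := trans v; have [h ->] := trans w; exists (h * g^-1).
  by rewrite /= /glue_actv /= -actvM mulgKV.
- move=> [[k1 e1]|e1] [[k2 e2]|e2] e' //= [->] [->].
  by exists (k2 * k1^-1); rewrite mulgKV.
Qed.

Lemma glue_connect z v w :
  connect (@adjacent (F z)) v w ->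
  connect (@adjacent glue_graph) (fibv v) (fibv w).
Proof.
case/connectP=> s + ->;
elim: s v => [|u s IHs] v //= /andP[/existsP[e /eqP eE]].
move=> /IHs; apply: connect_trans; apply/connect1/existsP; exists (fibe e).
by rewrite /= eE imsetU1 imset_set1.
Qed.

Hypothesis Xpos : 0 < #|vert X|.
Hypothesis tree : forall x y, connect (adjacent_in [set e | lab e == 1]) x y.

Variable K : {set gT}.
Hypothesis K_conn : forall k, k \in K ->
  exists z, connect (@adjacent (F z)) (p z) (actv (a z) k (p z)).
Hypothesis gen : <<K :|: [set lab e | e : edge X]>> = [set: gT].

(* The tree edges link all the base points, so the k carrying a base point into
   the component of the base points form a subgroup; it contains K and all the
   labels. *)
Lemma glue_connected : connected glue_graph.
Proof.
have csym := sym_connect_sym (_ : symmetric (@adjacent glue_graph)).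
have {csym} csym : connect_sym (@adjacent glue_graph).
  by apply: csym => u w; apply: eq_existsb => e; rewrite setUC.
pose c := connect (@adjacent glue_graph).
have hor k e : c (fibv (actv (a _) k (p (st e).1)))
                 (fibv (actv (a _) (k * lab e) (p (st e).2))).
  by apply/connect1/existsP; exists (inl (k, e)); rewrite /= eqxx.
(* Edges with label 1 lift without changing [k], so a path in the tree lifts at constant [k]. *)
have base x y k : c (fibv (actv (a x) k (p x))) (fibv (actv (a y) k (p y))).
  have /connectP[s + ->] := tree x y;
  elim: s x => [|u s IHs] x; first by rewrite /c connect0.
  case/andP=> /existsP[e /andP[]]; rewrite inE => /eqP e1 /eqP eE /IHs.
  apply: connect_trans; have := hor k e; rewrite e1 mulg1.
  have : x \in ends e by rewrite eE set21.
  have : u \in ends e by rewrite eE set22.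
  have : x != u by apply/eqP=> xu;
    have := ends_card e; rewrite eE xu setUid cards1.
  (* [st] may orient the edge against the path; symmetry of [c] settles that case. *)
  rewrite st_ends => xu /set2P[] uE /set2P[] xE;
  move: xu; rewrite xE uE ?eqxx //.
  by rewrite /c csym.
have /card_gt0P[r _] := Xpos.
pose M := [set k | c (fibv (p r)) (fibv (actv (a r) k (p r)))].
have MG : group_set M.
  apply/group_setP; split=> [|k l]; first by rewrite inE actv1 /c connect0.
  (* The path to the [k]-translate of [p r] is prolonged by the [k]-translate of the path for
     [l]. *)
  rewrite !inE => rk /(connect_act glue_act k) /=; rewrite /glue_actv /= -actvM.
  exact: connect_trans.
have base1 x y : c (fibv (p x)) (fibv (p y))
  by have := base x y 1; rewrite !actv1.
have allM k : k \in Group MG.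
  have : k \in [set: gT] by rewrite inE.
  rewrite -gen; apply: subsetP; rewrite gen_subG subUset; apply/andP; split.
    apply/subsetP=> l /K_conn[z /glue_connect zl]; rewrite inE.
    (* From [p r] along the lifted tree to [p z], inside the fibre to its [l]-translate, then back
       along the [l]-translated tree. *)
    by apply: connect_trans (base1 r z) (connect_trans zl (base z r l)).
  apply/subsetP=> l /imsetP[e _ ->]; rewrite inE.
  (* The same detour, with the edge [(1, e)] in place of the path inside a fibre. *)
  have := hor 1 e; rewrite actv1 mul1g => he.
  by apply: connect_trans (base1 r _) (connect_trans he (base _ r _)).
have fromr v : c (fibv (p r)) v.
  case: v => z v; have [g ->] := trans v; have := allM g; rewrite inE => rg.
  exact: connect_trans rg (base r z g).
split; first by apply/card_gt0P; exists (fibv (p r)).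
move=> v w; rewrite inE; apply: connect_trans (fromr w).
by rewrite csym; apply: fromr.
Qed.

Hypothesis fa : forall z, faithful_act (a z).

(** Faithfulness on a single fibre is enough, and [X] has a vertex. *)
Lemma glue_faithful : faithful_act glue_act.
Proof.
have /card_gt0P[r _] := Xpos.
move=> g gv ge; apply: (fa (z := r)) => [v|e].
  by apply: fibv_inj; apply: (gv (fibv v)).
by apply: fibe_inj; apply: (ge (fibe e)).
Qed.

Lemma glue_harmonic_act : harmonic_act glue_act.
Proof.
split; first exact: connected_faithful glue_connected glue_faithful.
by move=> H; apply: unflipped_harmonic glue_unflipped.
Qed.

Definition glue_cover : connected_cover gT X :=
  ConnectedCover glue_connected glue_faithful glue_harmonic_act glue_unflipped
    (quotient_iso_harmonic (glue_harmonic_act.2 _) glue_quotient_iso)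
    glue_invv glue_inve glue_quotient_iso.

(** Horizontal edges map to edges, so only the edges of [F z] are contracted to [z]. *)
Lemma glue_fiber z : act_iso (a z) (fiber_act glue_cover z).
Proof.
pose iv v : fvert glue_map z :=
  exist (fun w : vert glue_graph => mapv glue_map w == z) (fibv v) (eqxx z).
pose ie e : fedge glue_map z :=
  exist (fun w : edge glue_graph => mape glue_map w == inr z) (fibe e) (eqxx _).
have iv_inj : injective iv by move=> v w [] /(@fibv_inj z).
have iv_bij : bijective iv.
  apply: inj_surj_bij => // -[[z' v] vz]; have /= zz := eqP vz.
  by rewrite /glue_mapv /= in zz; subst z'; exists v; apply: val_inj.
have ie_bij : bijective ie.
  apply: inj_surj_bij => [e e' /(congr1 val)/
    (@fibe_inj z)//|[[[k e]|[z' e]] ez]] //.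
  by have [zz] := eqP ez; rewrite /= in zz; subst z'; exists e; apply: val_inj.
have iE e : ends (ie e : edge (fiber glue_map z)) = [set iv v | v in ends e].
  by apply: (imset_inj val_inj); rewrite fends_val -imset_comp.
exists (@GIso (F z) (fiber glue_map z) iv ie iv_bij ie_bij iE).
by split=> g x; apply: val_inj.
Qed.

End Gluing.

(** * Covers of a point and the actions induced from them *)

Lemma point_cover_trans (hT : finGroupType) (C : connected_cover hT point_graph)
  (v w : vert (cov_graph C)) : exists h, w = actv (cov_act C) h v.
Proof.
have [i _] := cov_quotient C; have iI := bij_inj (isov_bij i).
(* The quotient is isomorphic to a one-vertex graph, so any two orbits coincide. *)
have : qv (cov_act C) [set: hT] w = qv (cov_act C) [set: hT] v.
  by apply: iI; case: (isov i _); case: (isov i _).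
by move/eqP/qv_eqP=> [h _ ->]; exists h.
Qed.

Section InducedCover.
Variables (hT gT : finGroupType) (Y : mgraph) (a : gaction hT Y).
Variable phi : {morphism [set: hT] >-> gT}.
Hypothesis phi_inj : 'injm phi.

Local Notation ta := (twist_act a phi).
Local Notation ia := (induced_act a phi).

Definition iclass g (v : vert Y) : vert (induced_graph a phi) :=
  qv ta [set: hT] (g, v).

Lemma iclass_surj o : exists g v, o = iclass g v.
Proof.
by have [[g v] _ oE] := imsetP (valP o); exists g, v; apply: val_inj.
Qed.

(** This is the defining relation of the induced graph. *)
Lemma iclass_phi g h v : iclass (g * phi h) v = iclass g (actv a h v).
Proof.
rewrite /iclass -(@qv_act _ _ ta _ h (g * phi h, v)) ?inE //.
by rewrite /= /twist /= mulgK.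
Qed.

Lemma iclass_act k g v : actv ia k (iclass g v) = iclass (k * g) v.
Proof.
apply: val_inj => /=.
exact: (vorbit_im [set: hT] (@ltrans_twistv _ _ _ a phi) k (g, v)).
Qed.

Fact eclass_proof g e : eorbit ta [set: hT] (g, e)
  \in [set eorbit ta [set: hT] p | p : edge (prod_graph gT Y)
                                 & crossing ta [set: hT] p].
Proof. by apply: imset_f; rewrite inE twist_crossing. Qed.

(** Defined for every pair because injectivity of [phi] makes all edges of the product crossing. *)
Definition eclass g (e : edge Y) : edge (induced_graph a phi) :=
  exist (fun A => A \in [set eorbit ta [set: hT] p
    | p : edge (prod_graph gT Y) & crossing ta [set: hT] p]) _
    (eclass_proof g e).

Lemma eclass_surj A : exists g e, A = eclass g e.
Proof.
by have [[g e] _ AE] := imsetP (valP A); exists g, e; apply: val_inj.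
Qed.

Lemma eclass_ends g e : ends (eclass g e) = [set iclass g v | v in ends e].
Proof.
rewrite [ends _](@qends_orbit _ _ ta _ ((g, e) : edge (prod_graph gT Y))) //.
by rewrite [ends _]/= /pends -imset_comp; apply: eq_imset.
Qed.

(** Some twist by [h] takes [(g, e)] to [(k * g, e)]; the two coordinates give the two equations. *)
Lemma eclass_fix k g e : acte ia k (eclass g e) = eclass g e ->
  exists2 h, e = acte a h e & k * g = g * (phi h)^-1.
Proof.
move/(congr1 val) => /=.
rewrite (eorbit_im [set: hT] (@ltrans_twiste _ _ _ a phi)) => kA.
have := eorbit_refl ta [set: hT]%G (acte (ltrans_act gT Y) k (g, e)).
by rewrite kA => /imsetP[h _ []]; exists h.
Qed.

Lemma iclass_fix k g v : actv ia k (iclass g v) = iclass g v ->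
  exists2 h, v = actv a h v & k * g = g * (phi h)^-1.
Proof. by rewrite iclass_act => /eqP/qv_eqP[h _ []]; exists h. Qed.

Lemma iclass_adjacent g v w :
  adjacent v w -> adjacent (iclass g v) (iclass g w).
Proof.
case/existsP=> e /eqP eE; apply/existsP; exists (eclass g e).
by rewrite eclass_ends eE imsetU1 imset_set1.
Qed.

Lemma iclass_connect g v w :
    connect (@adjacent Y) v w ->
  connect (@adjacent (induced_graph a phi)) (iclass g v) (iclass g w).
Proof.
case/connectP=> s + ->; elim: s v => [|u s IHs] v //= /andP[vu /IHs].
exact/connect_trans/connect1/iclass_adjacent.
Qed.

(** Freeness on the edges of [Y] forces the twisting element to be 1, which leaves [k * g = g]. *)
Lemma induced_unflipped : unflipped a -> unflipped ia.
Proof.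
move=> unf k A; have [g [e ->]] := eclass_surj A.
case/eclass_fix=> h /esym/unf->; rewrite morph1 invg1 mulg1 => /eqP.
by rewrite -{2}[g]mul1g => /eqP/mulIg.
Qed.

(** On classes with first coordinate 1, the twisting element satisfies [k = (phi h)^-1]. By
    injectivity one [h] serves all vertices and edges, so it acts trivially on [Y]. *)
Lemma induced_faithful : 0 < #|vert Y| -> faithful_act a -> faithful_act ia.
Proof.
move=> /card_gt0P[y0 _] fa k kv ke.
have [h _] := iclass_fix (kv (iclass 1 y0)); rewrite mulg1 mul1g => kE.
have phiI h' : k * 1 = 1 * (phi h')^-1 -> h' = h.
  rewrite mulg1 mul1g kE => /invg_inj /(injmP phi_inj).
  by move=> /(_ (in_setT _) (in_setT _)).
rewrite kE (fa h) ?morph1 ?invg1 // => [v|e].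
  by have [h' {2}-> /phiI->] := iclass_fix (kv (iclass 1 v)).
by have [h' {2}-> /phiI->] := eclass_fix (ke (eclass 1 e)).
Qed.

Lemma induced_trans y : (forall v, exists h, v = actv a h y) ->
  forall o, exists k, o = actv ia k (iclass 1 y).
Proof.
move=> trans o; have [g [v ->]] := iclass_surj o; have [h ->] := trans v.
by exists (g * phi h); rewrite iclass_act mulg1 iclass_phi.
Qed.

(** [phi h] sends the class of [(1, y)] to that of [(1, h y)], in the same copy of the connected
    graph [Y]. *)
Lemma induced_base_connect y k : connected Y -> k \in phi @* [set: hT] ->
  connect (@adjacent (induced_graph a phi))
    (iclass 1 y) (actv ia k (iclass 1 y)).
Proof.
move=> [_ cY] /morphimP[h _ _ ->]; rewrite iclass_act mulg1
  -[phi h]mul1g iclass_phi.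
by apply: iclass_connect; have := cY y (actv a h y); rewrite inE.
Qed.

End InducedCover.

(** * The regular action, which serves as fibre outside [B] *)

Section Regular.
Variable gT : finGroupType.

Definition regular_graph : mgraph :=
  @MGraph gT void (fun e => match e with end) (fun e => match e with end).

Fact regular_ends (g : gT) (e : edge regular_graph) :
  ends e = [set g * v | v in ends e].
Proof. by case: e. Qed.

Definition regular_act : gaction gT regular_graph :=
  @GAction gT regular_graph (fun g v => g * v) (fun _ e => e) (@mul1g gT)
    (fun g h v => esym (mulgA g h v)) (fun _ => erefl) (fun _ _ _ => erefl)
    regular_ends.

Lemma regular_unflipped : unflipped regular_act.
Proof. by move=> g e; case: (e : void). Qed.

Lemma regular_faithful : faithful_act regular_act.
Proof. by move=> g /(_ 1) /=; rewrite mulg1. Qed.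

(** Without edges every component is a single vertex, and left translation is free. *)
Lemma regular_iso_stab (Y : mgraph) (a : gaction gT Y) (x : vert Y) :
  act_iso a regular_act -> component_stab a x = [set 1].
Proof.
case=> i [iE _]; have comp1 : component x = [set x].
  apply/setP=> y; rewrite !inE eq_sym;
  apply/idP/eqP=> [|->]; last exact: connect0.
  by case/connectP=> -[|z s] //= /andP[/existsP[e _]]; case: (isoe i e).
apply/setP=> g; rewrite !inE comp1 imset_set1 (inj_eq set1_inj).
rewrite -(inj_eq (bij_inj (isov_bij i))) iE /= -[X in _ == X]mul1g.
exact: (inj_eq (mulIg _)).
Qed.

End Regular.

(** * Choice of the fibres and assembly of the cover *)

Theorem theorem6p2 (X : mgraph) (hX : connected X) (g : nat)
    (hg : genus X = Posz g) (B : {set vert X}) (gT : finGroupType)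
    (Gb : {b : vert X | b \in B} -> finGroupType)
    (Yb : forall b : {b : vert X | b \in B}, connected_cover (Gb b) point_graph)
    (phi : forall b : {b : vert X | b \in B}, {morphism [set: Gb b] >-> gT})
    (phi_inj : forall b : {b : vert X | b \in B}, 'injm (phi b))
    (gamma : 'I_g -> gT)
    (hgen : <<(<<\bigcup_(b : {b : vert X | b \in B}) (phi b @* [set: Gb b])>>
                :|: [set gamma i | i : 'I_g])>> = [set: gT]) :
  exists C : connected_cover gT X,
    (forall z : vert X, z \notin B -> totally_split C z) /\
    (forall b : {b : vert X | b \in B},
       act_iso (fiber_act C (val b)) (induced_act (cov_act (Yb b)) (phi b))).
(* What the gluing requires of a fibre with base point over [z], together with its prescribed
   isomorphism type. *)
pose good z (d : {Y : mgraph & (gaction gT Y * vert Y)%type}) :=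
  let a := (tagged d).1 in let p := (tagged d).2 in
  [/\ unflipped a, faithful_act a, forall v, exists k, v = actv a k p,
      z \notin B -> act_iso a (regular_act gT)
    & forall b : {b | b \in B}, val b = z ->
        act_iso a (induced_act (cov_act (Yb b)) (phi b))
        /\ forall k, k \in phi b @* [set: Gb b] ->
             connect (@adjacent (tag d)) p (actv a k p)].
have [d dP] : exists d, forall z, good z (d z).
  apply: fin_all_exists => z; have [zB|zB] := boolP (z \in B); last first.
    exists (existT _ (regular_graph gT) (regular_act gT, 1)).
    split=> /= [||v|_|b bz].
    - exact: regular_unflipped.
    - exact: regular_faithful.
    - by exists v; rewrite mulg1.
    - exact: act_iso_refl.
    - by case/negP: zB; rewrite -bz; apply: valP.
  pose b : {b | b \in B} := exist (fun b => b \in B) z zB.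
  have [Ypos _] := cov_connected (Yb b); have /card_gt0P[y _] := Ypos.
  exists (existT _ (induced_graph (cov_act (Yb b)) (phi b))
    (induced_act (cov_act (Yb b)) (phi b), iclass _ (phi b) 1 y)).
  split=> /= [||||b' b'z].
  - exact: induced_unflipped (phi_inj b) (cov_unflipped (c := Yb b)).
  - exact: induced_faithful (phi_inj b) Ypos (cov_faithful (c := Yb b)).
  - by apply: induced_trans => v; apply: point_cover_trans.
  - by rewrite zB.
  - have -> : b' = b by apply: val_inj.
    split; first exact: act_iso_refl.
    by move=> k; apply: induced_base_connect => //; apply: cov_connected.
have [lab [labS tree]] := tree_labelling gamma hX hg.
have [st stE] := fin_all_exists (@edge_ends X).
pose K := \bigcup_(b : {b : vert X | b \in B}) (phi b @* [set: Gb b]).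
have K_conn k : k \in K -> exists z, connect (@adjacent (tag (d z)))
    (tagged (d z)).2 (actv (tagged (d z)).1 k (tagged (d z)).2).
  case/bigcupP=> b _ kb; exists (val b).
  by have [_ _ _ _ /(_ b erefl)[_]] := dP (val b); apply.
have gen : <<K :|: [set lab e | e : edge X]>> = [set: gT].
  (* The inner generated subgroup is generated by [K], and each [gamma i] is the label of some
     edge. *)
  apply/eqP; rewrite eqEsubset subsetT /= -hgen gen_subG subUset.
  rewrite genS ?subsetUl //=; apply/subsetP=> k /imsetP[i _ ->].
  by have [e <-] := labS i; rewrite mem_gen // inE imset_f ?orbT.
have unf z : unflipped (tagged (d z)).1 by have [] := dP z.
have fa z : faithful_act (tagged (d z)).1 by have [] := dP z.
have tr z : forall v, exists k, v = actv (tagged (d z)).1 k (tagged (d z)).2.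
  by have [] := dP z.
pose C := glue_cover stE unf tr (proj1 hX) tree K_conn gen fa.
have Cfib z : act_iso (fiber_act C z) (tagged (d z)).1.
  by apply: act_iso_sym; apply: glue_fiber.
(* Off [B] the fibre is the regular action, whose component stabilizers are trivial. *)
exists C; split=> [z zB ? ? x|b].
  have [_ _ _ /(_ zB) dR _] := dP z.
  exact: regular_iso_stab (act_iso_trans (Cfib z) dR).
have [_ _ _ _ /(_ b erefl)[dI _]] := dP (val b).
exact: act_iso_trans (Cfib _) dI.
Qed.
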